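(* Let $\beta$ be an arbitrary real number in $\bigl(1,\frac{1+\sqrt5}{2}\bigr)$. Then there exists $\kappa=\kappa(\beta)>0$ such that for every integer $m\ge2$, $$\liminf_{n\to\infty}\frac{\log_2\mathcal N_n(x;\beta)}{n}\ge\kappa\qquad\text{for any }x\in\Bigl(0,\frac{m-1}{\beta-1}\Bigr).$$
   Context: For a real $\beta>1$, an integer $m>\beta$ and $x\in[0,\frac{m-1}{\beta-1}]$, let $\mathcal E_n(x;\beta)$ be the set of words $(\varepsilon_1,\dots,\varepsilon_n)\in\{0,1,\dots,m-1\}^n$ for which there exists $(\varepsilon_{n+1},\varepsilon_{n+2},\dots)\in\{0,1,\dots,m-1\}^{\mathbb N}$ with $x=\sum_{k=1}^\infty\varepsilon_k\beta^{-k}$, and let $\mathcal N_n(x;\beta)=\#\mathcal E_n(x;\beta)$ (this depends also on $m$). *)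

(* Defs.v *)
From HB Require Import structures.
From mathcomp Require Import all_boot all_order all_algebra.
From mathcomp Require Import all_classical all_reals all_analysis.

Set Implicit Arguments.
Unset Strict Implicit.
Unset Printing Implicit Defensive.

Import Order.TTheory GRing.Theory Num.Theory.
Import numFieldNormedType.Exports.

Local Open Scope ring_scope.

(* Digits are indexed from 0 here, so [e k] is the (k+1)-st digit of x and
   carries the weight beta^-(k+1). *)
Definition beta_expansion (R : realType) (m : nat) (beta x : R)
    (e : nat -> 'I_m) : Prop :=
  (series (fun k => (e k : nat)%:R * beta ^- k.+1 : R) @ \oo --> x)%classic.

Definition prefixes (R : realType) (m : nat) (beta x : R) (n : nat) :
    {set n.-tuple 'I_m} :=
  [set w : n.-tuple 'I_m |
    `[< exists e : nat -> 'I_m,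
          beta_expansion beta x e /\ w = [tuple e i | i < n] >]]%SET.

Definition num_prefixes (R : realType) (m : nat) (beta x : R) (n : nat) : nat :=
  #|prefixes m beta x n|.

Definition log2 (R : realType) (y : R) : R := ln y / ln 2.

(* Main.v *)
Require Import Defs.
From HB Require Import structures.
From mathcomp Require Import all_boot all_order all_algebra.
From mathcomp Require Import all_classical all_reals all_analysis.
From mathcomp Require Import zify ring lra.

Import Order.TTheory GRing.Theory Num.Theory.
Import numFieldNormedType.Exports.

Set Implicit Arguments.
Unset Strict Implicit.
Unset Printing Implicit Defensive.

Local Open Scope classical_set_scope.
Local Open Scope ring_scope.

(** Put T_d(y) = beta * y - d.  If a word d_1 ... d_n is a prefix of an expansion
of x, then the digits after it expand T_{d_n}(... T_{d_1}(x)), the remainder of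
x after the word.  Conversely every remainder in [0, (m - 1)/(beta - 1)] has an
expansion, so the words with such a remainder are prefixes
([expansion_of_prefix]) and counting prefixes means counting orbits of a system
of expanding maps.

For the digits 0 and 1, let q = 1/(beta^2 - 1).  The points q and beta * q are
the values of the periodic digit sequences (01)^oo and (10)^oo.  They bound the
switch region S = [q, beta * q].  Its two images T_0(S) and T_1(S) have as
convex hull the central interval K = [beta * q - 1, q + 1].  The golden ratio
enters at one place: beta^2 < beta + 1 says exactly that beta * q > 1, so that K
is contained in the open interval (0, 1/(beta - 1)).  Three facts follow.
- From a point of S both digits lead into K ([switch_branch]).
- From a point of K some digit leads into K ([central_stay]).
- Every point away from 0 and 1/(beta - 1) reaches S in a bounded number of
  steps, by digits all equal to 0 or all equal to 1 ([switch_reach]).  The bound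
  is uniform on K.
Hence there is an L, depending on beta only, such that from a point of K the
number of words at least doubles every L steps ([many_words]).

For m digits, a shift reduces to the binary case with the same L.  If
x = j/(beta - 1) + y with 0 < y < 1/(beta - 1), then adding j to each digit of a
binary expansion of y gives an expansion of x in the digits j and j + 1
([remainder_addn]).  Only the points j/(beta - 1) are not of this form, and one
digit j - 1 moves such a point into a cell ([enter_cell]).  The constant
kappa = 1/(2 L) is therefore uniform in m and x. *)

(** * Prefixes as words with admissible remainder *)

Definition remainder (R : realType) (beta x : R) (w : seq nat) : R :=
  foldl (fun y d => beta * y - d%:R) x w.

Lemma remainder_cat (R : realType) (beta x : R) (v w : seq nat) :
  remainder beta x (v ++ w) = remainder beta (remainder beta x v) w.
Proof. exact: foldl_cat. Qed.

Lemma beta_expansion_cons (R : realType) (m : nat) (beta x : R) (d : 'I_m)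
    (e : nat -> 'I_m) : beta != 0 ->
  beta_expansion beta (beta * x - (d : nat)%:R) e ->
  beta_expansion beta x (fun k => if k is k'.+1 then e k' else d).
Proof.
move=> b0; pose e' k := if k is k'.+1 then e k' else d.
rewrite -/e' /beta_expansion => He.
have hs n : series (fun k => (e' k : nat)%:R * beta ^- k.+1) n.+1 =
    (d : nat)%:R / beta +
      beta^-1 * series (fun k => (e k : nat)%:R * beta ^- k.+1) n.
  rewrite /series /= big_nat_recl //= expr1; congr (_ + _).
  rewrite mulr_sumr; apply: eq_bigr => k _.
  by rewrite [in LHS]exprS invfM mulrCA.
rewrite -cvg_shiftS /= (funext hs).
have -> : x = (d : nat)%:R / beta + beta^-1 * (beta * x - (d : nat)%:R).
  by field.
apply: cvgD; first exact: cvg_cst.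
exact: cvgMr.
Qed.

(** The greedy choice works: take the integer part of beta * y, capped at m - 1.
Without the cap the new remainder is below 1, and 1 <= (m - 1)/(beta - 1)
because beta <= m; with the cap it is bounded because (m - 1)/(beta - 1) is the
fixed point of y |-> beta * y - (m - 1). *)
Lemma admissible_digit (R : realType) (m : nat) (beta y : R) :
  1 < beta -> beta <= m%:R ->
  exists d : 'I_m, 0 <= y <= (m%:R - 1) / (beta - 1) ->
    0 <= beta * y - (d : nat)%:R <= (m%:R - 1) / (beta - 1).
Proof.
move=> b1 bm.
have m2 : (1 < m)%N by rewrite -(ltr_nat R); exact: lt_le_trans bm.
have lt_dm : (minn (Num.trunc (beta * y)) m.-1 < m)%N by lia.
exists (Ordinal lt_dm) => /andP[y0 yc] /=.
have b10 : 0 < beta - 1 by lra.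
have c1 : 1 <= (m%:R - 1) / (beta - 1) by rewrite ler_pdivlMr //; lra.
have /truncn_itv : 0 <= beta * y by rewrite mulr_ge0 //; lra.
set t := Num.trunc _ => /andP[ht1 ht2].
have [le_tm|lt_mt] := leqP t m.-1.
  by move: ht2; rewrite -natr1 => ht2; apply/andP; split; lra.
have mm : m.-1%:R = m%:R - 1 :> R by rewrite -subn1 natrB //; lia.
have : (m.-1%:R : R) <= t%:R by rewrite ler_nat ltnW.
rewrite mm => hm; apply/andP; split; first lra.
have -> : (m%:R - 1) / (beta - 1) =
    beta * ((m%:R - 1) / (beta - 1)) - (m%:R - 1) by field; lra.
by rewrite lerD2r ler_pM2l //; lra.
Qed.

(** Iterating an admissible digit keeps the remainders z n bounded, and the n-th
partial sum misses x by z n * beta^-n. *)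
Lemma beta_expansion_exists (R : realType) (m : nat) (beta x : R) :
  1 < beta -> beta <= m%:R ->
  0 <= x <= (m%:R - 1) / (beta - 1) ->
  exists e : nat -> 'I_m, beta_expansion beta x e.
Proof.
move=> b1 bm hx.
have [g hg] := choice (fun y => admissible_digit y b1 bm).
set c := (m%:R - 1) / (beta - 1) in hg hx.
pose z n := iter n (fun y => beta * y - (g y : nat)%:R) x.
have hz n : 0 <= z n <= c by elim: n => //= n IH; exact: hg.
exists (fun k => g (z k)); rewrite /beta_expansion.
have bn0 n : beta ^+ n != 0 by rewrite expf_neq0 //; lra.
have hs n : series (fun k => (g (z k) : nat)%:R * beta ^- k.+1 : R) n
    = x - z n * beta ^- n.
  elim: n => [|n IH].
    by rewrite /series /= big_geq // expr0 invr1 mulr1 subrr.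
  rewrite seriesSr IH /= exprS; field.
  by rewrite bn0 lt0r_neq0 //; lra.
have hV : 0 <= beta^-1 < 1 by rewrite invr_ge0 invf_lt1; lra.
apply: (@squeeze_cvgr _ _ _ _ (fun n => x - c * beta^-1 ^+ n) (fun=> x)).
- apply: nearW => n; rewrite hs exprVn.
  have : 0 <= beta ^- n by rewrite invr_ge0 exprn_ge0; lra.
  move: (hz n) => /andP[zn0 znc] bp; apply/andP; split.
    by rewrite lerB // ler_wpM2r.
  by rewrite gerBl mulr_ge0.
- rewrite -[X in _ --> X]subr0; apply: cvgB; first exact: cvg_cst.
  rewrite -[X in _ --> X](mulr0 c); apply: cvgMr.
  by apply: cvg_expr; rewrite ger0_norm; case/andP: hV.
- exact: cvg_cst.
Qed.

Lemma expansion_of_prefix (R : realType) (m : nat) (beta x : R) (w : seq nat) :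
  1 < beta -> beta <= m%:R -> all (fun d => (d < m)%N) w ->
  0 <= remainder beta x w <= (m%:R - 1) / (beta - 1) ->
  exists e : nat -> 'I_m, beta_expansion beta x e /\
    mkseq (fun k => e k : nat) (size w) = w.
Proof.
move=> b1 bm; elim: w x => [|d w IH] x /=.
  by move=> _ /(beta_expansion_exists b1 bm)[e he]; exists e.
case/andP=> lt_dm wm /(IH _ wm)[e [he ew]].
exists (fun k => if k is k'.+1 then e k' else Ordinal lt_dm); split.
  by apply: beta_expansion_cons => //; lra.
rewrite /mkseq /= -[in RHS]ew; congr cons.
by rewrite -[1%N]addn0 iotaDl -map_comp.
Qed.

(** Words are sequences of naturals here, so that binary words and their shifts
need no change of type; the bound on the digits turns them into tuples over
'I_m. *)
Lemma leq_size_num_prefixes (R : realType) (m : nat) (beta x : R) (n : nat)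
    (ws : seq (seq nat)) :
  1 < beta -> beta <= m%:R -> uniq ws ->
  (forall w, w \in ws -> [/\ size w = n, all (fun d => (d < m)%N) w &
     0 <= remainder beta x w <= (m%:R - 1) / (beta - 1)]) ->
  (size ws <= num_prefixes m beta x n)%N.
Proof.
move=> b1 bm uws hws; rewrite /num_prefixes cardE.
pose f (t : n.-tuple 'I_m) := map (@nat_of_ord m) t.
rewrite -(size_map f); apply: uniq_leq_size => // w /hws[sw wm hw].
have [e [he ew]] := expansion_of_prefix b1 bm wm hw.
apply/mapP; exists [tuple e i | i < n].
  by rewrite mem_enum inE; apply/asboolP; exists e.
rewrite -[LHS]ew sw /f /= -map_comp /mkseq -val_enum_ord -map_comp.
by apply: eq_map => i.
Qed.

(** * The binary system *)

(** The first time that beta^n * y passes theta it has not yet passed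
beta * theta: an orbit of T_0 cannot jump over an interval whose endpoints have
ratio beta. *)
Lemma climb (R : realType) (beta a theta : R) : 1 < beta -> 0 < a ->
  exists N, forall y, a <= y -> y <= beta * theta ->
    exists n, (n <= N)%N /\ theta <= beta ^+ n * y <= beta * theta.
Proof.
move=> b1 a0.
have [N hN] : exists N, theta <= beta ^+ N * a.
  have hV : `|beta^-1| < 1 by rewrite ger0_norm ?invr_ge0 ?invf_lt1; lra.
  have hl : theta * beta^-1 ^+ n @[n --> \oo] --> 0.
    by rewrite -[X in _ --> X](mulr0 theta); apply: cvgMr; exact: cvg_expr.
  have [N _ /(_ N (leqnn N)) /= hN] := cvgr_lt 0 hl a a0.
  exists N; move: hN; rewrite exprVn ltr_pdivrMr; last by rewrite exprn_gt0 //; lra.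
  by rewrite mulrC => /ltW.
exists N => y ay yt.
have ex : exists n, theta <= beta ^+ n * y.
  exists N; apply: le_trans hN _; rewrite ler_wpM2l // exprn_ge0; lra.
case: (ex_minnP ex) => n hn nmin; exists n; split.
  apply: nmin; apply: le_trans hN _; rewrite ler_wpM2l // exprn_ge0; lra.
rewrite hn /=; case: n nmin {hn} => [|n] nmin; first by rewrite expr0 mul1r.
rewrite exprS -mulrA ler_pM2l; last lra.
by rewrite leNgt; apply/negP => /ltW /nmin; rewrite ltnn.
Qed.

Lemma remainder_nseq0 (R : realType) (beta y : R) n :
  remainder beta y (nseq n 0%N) = beta ^+ n * y.
Proof.
elim: n y => [|n IH] y /=; first by rewrite mul1r.
by rewrite IH exprSr subr0 mulrA.
Qed.

(** The reflection y |-> c - y, with c = 1/(beta - 1) the value of the constant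
sequence of ones, exchanges T_0 and T_1. *)
Lemma remainder_nseq1 (R : realType) (beta c y : R) n : (beta - 1) * c = 1 ->
  c - remainder beta y (nseq n 1%N) = beta ^+ n * (c - y).
Proof.
move=> hc; elim: n y => [|n IH] y /=; first by rewrite mul1r.
by rewrite IH exprSr -mulrA; congr (_ * _); lra.
Qed.

(** Adding j to all digits translates the system by j times the value c of the
constant sequence of ones. *)
Lemma remainder_addn (R : realType) (beta c y : R) j w : (beta - 1) * c = 1 ->
  remainder beta (j%:R * c + y) (map (addn j) w) =
  j%:R * c + remainder beta y w.
Proof.
move=> hc; elim: w y => //= d w IH y; rewrite -IH; congr remainder.
rewrite natrD; transitivity (j%:R * c + (beta * y - d%:R) +
   j%:R * ((beta - 1) * c - 1)); first ring.
by rewrite hc subrr mulr0 addr0.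
Qed.

(** With q = 1/(beta^2 - 1), this is the interval from T_1(q) to T_0(beta * q). *)
Definition central (R : realType) (beta q y : R) := beta * q - 1 <= y <= q + 1.

Lemma switch_facts (R : realType) (beta : R) (q := (beta ^+ 2 - 1)^-1) :
  1 < beta -> beta ^+ 2 < beta + 1 ->
  [/\ 0 < q, beta * (beta * q) = q + 1, 1 < beta * q,
      beta * q <= q + 1
      & beta * q + beta <= q + 2 /\ (beta - 1)^-1 = q + beta * q].
Proof.
move=> b1 b2.
have p0 : 0 < beta ^+ 2 - 1 by rewrite subr_gt0 exprn_egt1.
have q0 : 0 < q by rewrite invr_gt0.
have hq : beta ^+ 2 * q = q + 1.
  by rewrite -[X in _ = _ + X](mulVf (lt0r_neq0 p0)) -/q; ring.
have h1 : (beta - 1) * (q + beta * q) = 1.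
  by transitivity (beta ^+ 2 * q - q); [ring|rewrite hq; ring].
have cE : (beta - 1)^-1 = q + beta * q.
  by rewrite -[RHS](mulKf (x := beta - 1)) ?h1 ?mulr1 //; lra.
split=> //; last split=> //.
- by rewrite -hq; ring.
- nra.
- nra.
- nra.
Qed.

(** The digit is 0 up to the right end beta * q of the switch region and 1 beyond
it. *)
Lemma central_stay (R : realType) (beta y : R) (q := (beta ^+ 2 - 1)^-1) :
  1 < beta -> beta ^+ 2 < beta + 1 -> central beta q y ->
  exists d, (d < 2)%N /\ central beta q (beta * y - d%:R).
Proof.
move=> b1 b2 /andP[y1 y2].
have [q0 hq bq1 bq2 [bq3 _]] := switch_facts b1 b2; rewrite -/q in q0 hq bq1 bq2 bq3.
have [hy|hy] := leP y (beta * q); [exists 0%N|exists 1%N]; split=> //;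
  rewrite /central; apply/andP; split; nra.
Qed.

Lemma switch_branch (R : realType) (beta y : R) (d : nat)
    (q := (beta ^+ 2 - 1)^-1) :
  1 < beta -> beta ^+ 2 < beta + 1 -> q <= y <= beta * q -> (d < 2)%N ->
  central beta q (beta * y - d%:R).
Proof.
move=> b1 b2 /andP[y1 y2].
have [q0 hq bq1 bq2 [bq3 _]] := switch_facts b1 b2; rewrite -/q in q0 hq bq1 bq2 bq3.
by case: d => [|[|//]] _; rewrite /central; apply/andP; split; nra.
Qed.

(** Up to beta * q the orbit of T_0 climbs into the switch region.  Beyond
beta * q the reflection y |-> (beta - 1)^-1 - y, which preserves the region
because its endpoints add up to (beta - 1)^-1, reduces to the first case. *)
Lemma switch_reach (R : realType) (beta a : R) (q := (beta ^+ 2 - 1)^-1) :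
  1 < beta -> beta ^+ 2 < beta + 1 -> 0 < a ->
  exists N, forall y, a <= y <= (beta - 1)^-1 - a ->
    exists w, [/\ (size w <= N)%N, all (fun d => (d < 2)%N) w
      & q <= remainder beta y w <= beta * q].
Proof.
move=> b1 b2 a0.
have [q0 hq bq1 bq2 [bq3 cE]] := switch_facts b1 b2.
rewrite -/q in q0 hq bq1 bq2 bq3 cE.
rewrite cE.
have hc : (beta - 1) * (q + beta * q) = 1 by rewrite -cE mulfV //; lra.
have [N hN] := climb q b1 a0.
exists N => y /andP[y1 y2].
have [hy|hy] := leP y (beta * q).
  have [n [nN hn]] := hN _ y1 hy.
  exists (nseq n 0%N); rewrite size_nseq remainder_nseq0 all_nseq orbT.
  by split.
have [||n [nN hn]] := hN (q + beta * q - y); [lra|nra|].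
exists (nseq n 1%N); rewrite size_nseq all_nseq orbT; split=> //.
move: hn; rewrite -remainder_nseq1 //; lra.
Qed.

(** L is one more than the uniform time to reach the switch region from the
central interval: each block of at most L steps contains one free binary choice.
Blocks may be shorter than L, so the claim is made for every length
n >= k * L, and the leftover steps are spent inside the central interval. *)
Lemma many_words (R : realType) (beta : R) (q := (beta ^+ 2 - 1)^-1) :
  1 < beta -> beta ^+ 2 < beta + 1 ->
  exists2 L, (0 < L)%N & forall k n y, (k * L <= n)%N -> central beta q y ->
    exists ws : seq (seq nat), [/\ uniq ws, size ws = (2 ^ k)%N
      & forall w, w \in ws -> [/\ size w = n, all (fun d => (d < 2)%N) w
          & central beta q (remainder beta y w)]].
Proof.
move=> b1 b2.
have [q0 hq bq1 bq2 [bq3 cE]] := switch_facts b1 b2.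
rewrite -/q in q0 hq bq1 bq2 bq3 cE.
have a0 : 0 < beta * q - 1 by lra.
have [N hN] := switch_reach b1 b2 a0.
exists N.+1 => //; elim=> [|k IH] n y.
  move=> _; elim: n y => [|n IHn] y yK.
    by exists [:: [::]]; split=> // w; rewrite inE => /eqP->.
  have [d [d2 /IHn[ws [uws sws hws]]]] := central_stay b1 b2 yK.
  exists (map (cons d) ws); split.
  - by rewrite map_inj_uniq // => u v [].
  - by rewrite size_map.
  - move=> _ /mapP[w /hws[sw w2 hw] ->] /=.
    by rewrite sw d2 w2.
rewrite mulSn => kn yK.
have [|u [uN u2 hu]] := hN y.
  by rewrite cE; move: yK; rewrite /central; lra.
pose n' := (n - size u - 1)%N.
have kn' : (k * N.+1 <= n')%N by rewrite /n'; move: kn uN; clear; lia.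
have sn : n = (size u + n'.+1)%N by rewrite /n'; move: kn uN; clear; lia.
(* The digit at position [size u] separates the two halves of the family. *)
have branch d : (d < 2)%N -> exists ws : seq (seq nat),
    [/\ uniq ws, size ws = (2 ^ k)%N & forall w, w \in ws -> [/\ size w = n,
      all (fun d => (d < 2)%N) w, central beta q (remainder beta y w)
      & nth 0%N w (size u) = d]].
  move=> d2.
  have [ws [uws sws hws]] := IH _ _ kn' (switch_branch b1 b2 hu d2).
  exists (map (cat (rcons u d)) ws); split.
  - by rewrite map_inj_uniq // => v w /eqP; rewrite eqseq_cat // eqxx => /eqP.
  - by rewrite size_map.
  - move=> _ /mapP[w /hws[sw w2 hw] ->]; rewrite cat_rcons; split.
    + by rewrite size_cat /= sw -sn.
    + by rewrite all_cat u2 /= d2.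
    + by rewrite remainder_cat.
    + by rewrite nth_cat ltnn subnn.
have [ws0 [u0 s0 h0]] := branch 0%N isT.
have [ws1 [u1 s1 h1]] := branch 1%N isT.
exists (ws0 ++ ws1); split.
- rewrite cat_uniq u0 u1 andbT /=; apply/hasPn => w /h1[_ _ _ hw1].
  by apply/negP => /h0[_ _ _ hw0]; rewrite hw0 in hw1.
- by rewrite size_cat s0 s1 expnS mul2n addnn.
- by move=> w; rewrite mem_cat => /orP[/h0[]|/h1[]].
Qed.

(** * Reduction of m digits to two *)

(** The points j/(beta - 1) cut the domain of x into m - 1 cells.  A cut point is
sent by the digit j - 1 to its translate by 1, which is inside the next cell
because 1 < 1/(beta - 1). *)
Lemma enter_cell (R : realType) (beta x : R) (m : nat) :
  1 < beta -> beta < 2 -> 0 < x -> x < (m%:R - 1) / (beta - 1) ->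
  exists j (u : seq nat), [/\ (j.+1 < m)%N, all (fun d => (d < m)%N) u
    & 0 < remainder beta x u - j%:R / (beta - 1) < (beta - 1)^-1].
Proof.
move=> b1 b2 x0 xm; set p := beta - 1 in xm *.
have p0 : 0 < p by rewrite /p; lra.
have p1 : p < 1 by rewrite /p; lra.
have xp0 : 0 <= x * p by rewrite mulr_ge0 ?ltW.
rewrite ltr_pdivlMr // in xm.
have /andP[t1 t2] := truncn_itv xp0; set t := Num.trunc (x * p) in t1 t2.
have tm : (t.+1 < m)%N.
  by rewrite -(ltr_nat R) -natr1; lra.
rewrite -natr1 in t2.
move: t1; rewrite le_eqVlt => /orP[/eqP t1|t1]; last first.
  exists t, [::]; split=> //=.
  by rewrite subr_gt0 ltr_pdivrMr // t1 /= -(ltr_pM2r p0) mulrBl mulVf ?divfK; lra.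
have t0 : (0 < t)%N by rewrite -(ltr_nat R) t1 mulr_gt0.
exists t, [:: t.-1]; split=> //=; first by rewrite andbT; lia.
have -> : (t.-1%:R : R) = x * p - 1 by rewrite -t1 -subn1 natrB.
rewrite t1 mulfK; last lra.
have -> : beta * x - (x * p - 1) - x = 1 by rewrite /p; ring.
by rewrite ltr01 invf_gt1.
Qed.

(** L is chosen before m and x; only the delay n0, the time needed to enter a cell
and then its central interval, depends on them. *)
Lemma exponential_prefixes (R : realType) (beta : R) :
  1 < beta -> beta ^+ 2 < beta + 1 ->
  exists2 L, (0 < L)%N & forall m, (2 <= m)%N -> forall x,
    0 < x -> x < (m%:R - 1) / (beta - 1) ->
    exists n0, forall k n, (n0 + k * L <= n)%N ->
      (2 ^ k <= num_prefixes m beta x n)%N.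
Proof.
move=> b1 b2.
have lt_b2 : beta < 2 by nra.
have [L L0 hL] := many_words b1 b2; exists L => // m m2 x x0 xm.
have [q0 hq bq1 bq2 [bq3 cE]] := switch_facts b1 b2.
set q := (beta ^+ 2 - 1)^-1 in q0 hq bq1 bq2 bq3 cE hL.
have p0 : 0 < beta - 1 by lra.
have [j [u [jm um]]] := enter_cell b1 lt_b2 x0 xm.
set y := _ - _ => /andP[y0 yc].
have a0 : 0 < Num.min y ((beta - 1)^-1 - y) by rewrite lt_min y0 subr_gt0.
have [N hN] := switch_reach b1 b2 a0; rewrite -/q in hN.
have [|v [_ v2 hv]] := hN y.
  by rewrite ge_min lexx /= lerBrDr -lerBrDl ge_min lexx orbT.
have vK : central beta q (remainder beta y v).
  by move: hv; rewrite /central; lra.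
exists (size u + size v)%N => k n kn.
have [|ws [uws sws hws]] := hL k (n - size u - size v)%N _ _ vK.
  by move: kn; clear; lia.
pose f w := u ++ map (addn j) (v ++ w).
rewrite -sws -(size_map f); apply: leq_size_num_prefixes => //.
- by apply: le_trans (ltW lt_b2) _; rewrite ler_nat.
- rewrite map_inj_uniq // => w1 w2 /eqP; rewrite /f eqseq_cat // eqxx /=.
  by move=> /eqP /(inj_map (@addnI j)) /eqP; rewrite eqseq_cat // eqxx => /eqP.
move=> _ /mapP[w /hws[sw w2 hw] ->]; rewrite /f; split.
- rewrite size_cat size_map size_cat sw -subnDA addnA subnKC //.
  exact: leq_trans (leq_addr _ _) kn.
- rewrite all_cat um all_map all_cat /=; apply/andP; split.
    by apply: sub_all v2 => d /=; move: jm; clear; lia.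
  by apply: sub_all w2 => d /=; move: jm; clear; lia.
rewrite remainder_cat -[remainder beta x u](subrKC (j%:R / (beta - 1))) -/y.
rewrite remainder_addn ?mulfV //; last lra.
rewrite remainder_cat; move: hw; set z := remainder _ _ _ => hw.
have : (j.+2%:R : R) <= m%:R by rewrite ler_nat.
rewrite -!natr1 cE => jm'; have j0 : 0 <= j%:R :> R by [].
move: hw; rewrite /central => /andP[z1 z2]; apply/andP; split; first nra.
apply: (@le_trans _ _ ((j%:R + 1) * (q + beta * q))); first lra.
by rewrite ler_wpM2r //; lra.
Qed.

(** * The growth rate *)

Lemma limn_einf_ge (R : realType) (u : nat -> \bar R) (l : \bar R) (n0 : nat) :
  (forall n, (n0 <= n)%N -> (l <= u n)%E) -> (l <= limn_einf u)%E.
Proof.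
move=> hu; rewrite limn_einf_lim; apply: lime_ge; first exact: is_cvg_einfs.
exists n0 => // n /= le_n; apply: le_ereal_inf_tmp => _ [k /= le_k <-].
by apply: hu; apply: leq_trans le_k.
Qed.

(** The golden ratio is the positive root of t^2 = t + 1. *)
Lemma golden_sqr (R : realType) (beta : R) :
  1 < beta -> beta < (1 + Num.sqrt 5) / 2 -> beta ^+ 2 < beta + 1.
Proof.
move=> b1 bphi.
have s0 : 0 <= Num.sqrt 5 :> R by rewrite sqrtr_ge0.
have s2 : Num.sqrt 5 ^+ 2 = 5 :> R by rewrite sqr_sqrtr.
nra.
Qed.

Theorem theorem1p5 (R : realType) (beta : R)
    (hbeta1 : 1 < beta) (hbeta2 : beta < (1 + Num.sqrt 5) / 2) :
  exists kappa : R, 0 < kappa /\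
    forall m : nat, (2 <= m)%N ->
    forall x : R, 0 < x -> x < (m%:R - 1) / (beta - 1) ->
      (kappa%:E <=
        limn_einf (fun n : nat =>
          (log2 (num_prefixes m beta x n)%:R / n%:R)%:E))%E.
Proof.
have [L L0 hL] := exponential_prefixes hbeta1 (golden_sqr hbeta1 hbeta2).
have L0R : 0 < L%:R :> R by rewrite ltr0n.
exists (2 * L%:R)^-1; split; first by rewrite invr_gt0 mulr_gt0.
move=> m m2 x x0 xm; have [n0 hn0] := hL m m2 x x0 xm.
(* Past this rank the delay n0 and the rounding of (n - n0) / L together cost at
   most half of the n / L doublings. *)
apply: (@limn_einf_ge _ _ _ (2 * (n0 + L))) => n le_n.
rewrite lee_fin.
pose k := ((n - n0) %/ L)%N.
have hk : (n <= k * (2 * L))%N.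
  have := divn_eq (n - n0) L; have := ltn_pmod (n - n0) L0; rewrite -/k; nia.
have k2 : (2 ^ k <= num_prefixes m beta x n)%N.
  by apply: hn0; have := leq_trunc_div (n - n0) L; rewrite -/k; lia.
have ln2 : 0 < ln 2 :> R by rewrite ln_gt0 // ltr1n.
have nR : 0 < n%:R :> R by rewrite ltr0n; lia.
rewrite ler_pdivlMr // mulrC ler_pdivrMr ?mulr_gt0 //.
apply: (@le_trans _ _ (k%:R * (2 * L%:R))).
  by rewrite -!natrM ler_nat.
rewrite ler_pM2r ?mulr_gt0 // /log2 ler_pdivlMr // mulr_natl -lnXn //.
rewrite ler_ln ?posrE ?exprn_gt0 //.
  by rewrite -natrX ler_nat.
by rewrite ltr0n (leq_trans _ k2) // expn_gt0.
Qed.
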